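(* Let $G=(V,E)$ be a hedgegraph and $k$ a positive integer. Then $G$ is $k$-partition connected if and only if there exist pairwise disjoint sets $E_1,\dots,E_k\subseteq E$ such that each sub-hedgegraph $(V,E_i)$ is $1$-partition connected.
   Context: A hedgegraph $G=(V,E)$ consists of a finite vertex set $V$ and a finite set $E$ of hedges; each hedge is a set of hyperedges (subsets of $V$), the hyperedges within one hedge are pairwise vertex-disjoint, and no hyperedge belongs to two hedges. For $A\subseteq E$, $(V,A)$ is the sub-hedgegraph with hedge set $A$. For a partition $\mathcal{P}$ of $V$ into nonempty parts, $\delta(\mathcal{P})$ (relative to a given hedge set) is the set of hedges containing a hyperedge that intersects at least two parts of $\mathcal{P}$. The partition connectivity is $\mathrm{PC}_G=\min_{\mathcal{P}}\lfloor |\delta(\mathcal{P})|/(|\mathcal{P}|-1)\rfloor$ over partitions $\mathcal{P}$ of $V$ (with $0/0=+\infty$). $G$ is $k$-partition connected if $\mathrm{PC}_G\ge k$; equivalently $|\delta(\mathcal{P})|\ge k(|\mathcal{P}|-1)$ for every partition $\mathcal{P}$ of $V$. *)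

(* Defs.v *)
From mathcomp Require Import all_boot all_order all_algebra.
From mathcomp Require Import constructive_ereal.

Set Implicit Arguments.
Unset Strict Implicit.
Unset Printing Implicit Defensive.

Import Order.TTheory GRing.Theory Num.Theory.

(* [trivIset] says that the distinct members of a set of sets are pairwise
   disjoint: for the hedge [e] this is vertex-disjointness of its hyperedges,
   for [hedges] it says that no hyperedge lies in two hedges. *)
Record hedgegraph (V : finType) := Hedgegraph {
  hedges : {set {set {set V}}};
  trivIset_hedge : forall e, e \in hedges -> trivIset e;
  trivIset_hedges : trivIset hedges
}.

Lemma sub_trivIset_hedge (V : finType) (G : hedgegraph V)
    (A : {set {set {set V}}}) (sAG : A \subset hedges G) :
  forall e, e \in A -> trivIset e.
Proof. by move=> e eA; apply: (trivIset_hedge (subsetP sAG e eA)). Qed.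

Definition subhedgegraph (V : finType) (G : hedgegraph V)
    (A : {set {set {set V}}}) (sAG : A \subset hedges G) : hedgegraph V :=
  Hedgegraph (sub_trivIset_hedge sAG)
             (trivIsetS sAG (trivIset_hedges G)).

Definition delta (V : finType) (G : hedgegraph V) (P : {set {set V}}) :
    {set {set {set V}}} :=
  [set e in hedges G |
    [exists h in e, 1 < #|[set B in P | ~~ [disjoint h & B]]|]].

Local Open Scope ring_scope.

(* [divz] is the floor of the quotient for every positive divisor. Division by
   zero is only met as 0/0, for the partition into one part. If V is empty, its
   only partition has no part, and contributes the value 0 %/ (-1) = 0. *)
Definition partition_ratio (V : finType) (G : hedgegraph V)
    (P : {set {set V}}) : \bar int :=
  if #|P| == 1%N then +oo%E
  else ((#|delta G P|%:Z %/ (#|P|%:Z - 1))%Z)%:E.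

Definition partition_connectivity (V : finType) (G : hedgegraph V) : \bar int :=
  \big[Order.min/+oo%E]_(P : {set {set V}} | partition P [set: V])
    partition_ratio G P.

Definition partition_connected (V : finType) (k : nat) (G : hedgegraph V) :
    bool :=
  (k%:Z%:E <= partition_connectivity G)%E.

(* Main.v *)
(* Colour the edges of the complete graph on V with k colours and represent the
   edge uv of colour i by the vector (u, i) - (v, i) in the rational vector
   space on V x {1, ..., k}; the rank is that of k disjoint copies of the graphic
   matroid. For the family of sets of coloured edges lying inside the hedges,
   the deficiency condition of Rado's theorem, applied to the partition of V
   into the components of a subfamily, is k-partition connectivity. Rado's
   theorem then selects at most one coloured edge per hedge so that the
   selected edges have rank k (|V| - 1), that is, form a connected graph in each
   colour; E_i is the set of the hedges whose edge has colour i. *)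
Require Import Defs.
From mathcomp Require Import all_boot all_order all_algebra.
From mathcomp Require Import constructive_ereal zify.

Set Implicit Arguments.
Unset Strict Implicit.
Unset Printing Implicit Defensive.

Import Order.TTheory GRing.Theory Num.Theory.

(** * Partition connectivity as an integer inequality *)

(** Nonemptiness is a separate clause: for empty [V] the ratio of the empty partition is 0 < [k],
    whereas truncated subtraction makes the inequality hold. *)
Lemma partition_connectedP (V : finType) (G : hedgegraph V) (k : nat) :
  0 < k ->
  reflect (0 < #|V| /\ forall P : {set {set V}}, partition P [set: V] ->
             k * (#|P| - 1) <= #|delta G P|)
          (partition_connected k G).
Proof.
move=> k_gt0.
(* With [V] nonempty and [#|P|] different from 1, this makes the divisor [#|P| - 1] positive. *)
have card_part (P : {set {set V}}) : partition P [set: V] ->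
    (0 < #|P|) = (0 < #|V|).
  move=> partP; have -> : #|V| = #|[set: V]| by rewrite cardsT.
  rewrite (card_partition partP).
  have [->|[B PB]] := set_0Vmem P; first by rewrite cards0 big_set0.
  rewrite (bigD1 B) //= addn_gt0 card_gt0 (partition_neq0 partP PB) /=.
  by rewrite card_gt0; apply/set0Pn; exists B.
apply: (iffP (bigmin_geP _ _ _ _)) => [[_ le_k]|[V_gt0 le_k]].
  have V_gt0 : 0 < #|V|.
    rewrite lt0n; apply/negP => /eqP V0.
    have part0 : partition set0 [set: V].
      rewrite (_ : [set: V] = set0) ?partition_set0 //.
      by apply/eqP; rewrite -cards_eq0 cardsT V0.
    have delta0 : delta G set0 = set0.
      apply/setP => e; rewrite !inE; apply/negP => /andP[_ /exists_inP[h _]].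
      rewrite (_ : [set _ in _ | _] = set0) ?cards0 //.
      by apply/setP => B; rewrite !inE.
    have := le_k _ part0; rewrite /partition_ratio delta0 !cards0 /=.
    by rewrite lee_fin div0z; lia.
  split=> // P partP; have := le_k P partP; rewrite /partition_ratio.
  case: eqP => [-> | P1]; first by rewrite muln0.
  have := card_part P partP; rewrite V_gt0 => P_gt0.
  rewrite lee_fin lez_divRL; last by lia.
  by lia.
split=> [|P partP]; first by rewrite leey.
rewrite /partition_ratio; case: eqP => [_|P1]; first by rewrite leey.
have := le_k P partP; have := card_part P partP; rewrite V_gt0 => P_gt0.
rewrite lee_fin lez_divRL; last by lia.
by lia.
Qed.

(** * Rado's theorem for a monotone submodular function *)

(* Deleting one of two points [x], [y] of some [X e] keeps the hypothesis:
   were it violated by [A] after deleting [x] and by [B] after deleting [y],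
   submodularity would give a violation by [A :|: B] or [A :&: B :\ e]. *)
Lemma rado_deficiency (E T : finType) (f : {set T} -> nat) (H : {set E})
    (R : nat) (X : E -> {set T}) :
  {homo f : A B / A \subset B >-> A <= B} ->
  (forall A B, f (A :|: B) + f (A :&: B) <= f A + f B) ->
  (forall A : {set E}, R <= f (\bigcup_(e in A) X e) + #|H :\: A|) ->
  exists x : E -> {set T},
    (forall e, x e \subset X e /\ #|x e| <= 1) /\
    R <= f (\bigcup_(e in H) x e).
Proof.
move=> f_mono f_submod.
have [n] := ubnP (\sum_e #|X e|); elim: n X => // n IHn X lt_n leR.
(* Once no [X e] has two points, [X] is itself the selection, and the hypothesis at [A := H] is the
   claim. *)
have [/forallP le1|] := boolP [forall e, #|X e| <= 1].
  exists X; split=> // ; have := leR H.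
  by rewrite setDv cards0 addn0.
rewrite negb_forall => /existsP[e]; rewrite -ltnNge => /card_gt1P[x [y [xX yX xy]]].
pose del z e' := if e' == e then X e :\ z else X e'.
have del_sub z e' : del z e' \subset X e'.
  by rewrite /del; case: eqP => [->|//]; apply: subsetDl.
have [/existsP[z /andP[zX /forallP leRz]]|] :=
    boolP [exists z, (z \in X e) &&
      [forall A : {set E}, R <= f (\bigcup_(e' in A) del z e') + #|H :\: A|]].
  have [|u [u_del leRu]] := IHn (del z) _ leRz.
    rewrite -ltnS (leq_trans _ lt_n) // ltnS.
    rewrite (bigD1 e) // [X in _ < X](bigD1 e) //= /del eqxx.
    rewrite (cardsD1 z (X e)) zX add1n addSn ltnS leq_add2l leq_sum // => i /negPf ->.
    exact: leqnn.
  exists u; split=> // e'; have [ux ->] := u_del e'.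
  by split=> //; apply: subset_trans ux _.
rewrite negb_exists => /forallP noz.
(* A violating [A] contains [e]: otherwise the deletion leaves its union unchanged. *)
have viol z : z \in X e -> exists2 A : {set E}, e \in A &
    f (\bigcup_(e' in A) del z e') + #|H :\: A| < R.
  move=> zX; have := noz z; rewrite zX /= negb_forall => /existsP[A].
  rewrite -ltnNge => ltA; exists A => //; apply: contraLR ltA => eA.
  rewrite -leqNgt (leq_trans (leR A)) // leq_add2r f_mono //.
  apply/bigcupsP => e' e'A; rewrite (_ : X e' = del z e') ?bigcup_sup //.
  by rewrite /del; case: eqP e'A => // ->; rewrite (negPf eA).
have [A eA ltA] := viol x xX; have [B eB ltB] := viol y yX.
have := f_submod (\bigcup_(e' in A) del x e') (\bigcup_(e' in B) del y e').
(* The point [x], deleted from [X e] on the left, survives on the right, where only [y] is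
   deleted. *)
have leU : f (\bigcup_(e' in A :|: B) X e') <=
    f ((\bigcup_(e' in A) del x e') :|: (\bigcup_(e' in B) del y e')).
  apply/f_mono/subsetP => t /bigcupP[e' e'AB te'].
  have [e'e|e'e] := eqVneq e' e.
    have [tx|tx] := eqVneq t x; apply/setUP.
      right; apply/bigcupP; exists e => //.
      by rewrite /del eqxx !inE tx xy xX.
    left; apply/bigcupP; exists e => //.
    by rewrite /del eqxx !inE tx -e'e.
  case/setUP: e'AB => e'AB; apply/setUP; [left|right]; apply/bigcupP;
    by exists e' => //; rewrite /del (negPf e'e).
have leI : f (\bigcup_(e' in (A :&: B) :\ e) X e') <=
    f ((\bigcup_(e' in A) del x e') :&: (\bigcup_(e' in B) del y e')).
  apply/f_mono/subsetP => t /bigcupP[e'].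
  rewrite !inE => /and3P[/negPf e'e e'A e'B] te'.
  by apply/andP; split; apply/bigcupP; exists e' => //; rewrite /del e'e.
(* Dropping [e] from the intersection costs at most 1, while the two strict violations leave a slack
   of 2. *)
have cardU : #|H :\: (A :|: B)| + #|H :\: ((A :&: B) :\ e)| <=
    #|H :\: A| + #|H :\: B| + 1.
  have := cardsUI (H :\: A) (H :\: B); rewrite -setDIr -setDUr.
  have : #|H :\: ((A :&: B) :\ e)| <= #|H :\: (A :&: B)| + 1.
    rewrite -(cards1 e) (leq_trans _ (leq_card_setU _ _)) //.
    apply/subset_leq_card/subsetP => e'; rewrite !inE.
    by case: (e' == e); case: (e' \in A); case: (e' \in B); case: (e' \in H).
  by lia.
have := leR (A :|: B); have := leR ((A :&: B) :\ e).
lia.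
Qed.

(** * Linear rank *)

Section DifferenceRank.
Variable T : finType.

Definition axis (t : T) : 'rV[rat]_#|T| := delta_mx ord0 (enum_rank t).

Lemma card_leq_dim (W : {vspace 'rV[rat]_#|T|}) :
  (forall t, axis t \in W) -> #|T| <= \dim W.
Proof.
move=> axisW; have -> : W = fullv.
  apply/eqP; rewrite eqEsubv subvf; apply/subvP => u _.
  rewrite (row_sum_delta u) memv_suml // => j _.
  by rewrite memvZ // -[j]enum_valK axisW.
by rewrite dimvf dim_matrix mul1r.
Qed.

End DifferenceRank.

Section LinearRank.
Variables (K : fieldType) (U : vectType K) (T : finType) (vec : T -> U).
Implicit Types A B : {set T}.

Definition rank A := \dim <<[seq vec t | t in A]>>%VS.

Lemma vec_span A t : t \in A -> vec t \in <<[seq vec t | t in A]>>%VS.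
Proof. by move=> tA; apply/memv_span/image_f. Qed.

Lemma span_imageP A (W : {vspace U}) :
  (forall t, t \in A -> vec t \in W) -> (<<[seq vec t | t in A]>> <= W)%VS.
Proof. by move=> AW; apply/span_subvP => _ /imageP[t tA ->]; apply: AW. Qed.

Lemma rank_leq_card A : rank A <= #|A|.
Proof. by rewrite (leq_trans (dim_span _)) ?size_image. Qed.

Lemma rank_mono : {homo rank : A B / A \subset B >-> A <= B}.
Proof.
move=> A B /subsetP AB; apply/dimvS/span_imageP => t tA.
exact/vec_span/AB.
Qed.

(** The span of the union lies in the sum of the spans, that of the intersection in their meet; the
    dimension formula concludes. *)
Lemma rank_submod A B : rank (A :|: B) + rank (A :&: B) <= rank A + rank B.
Proof.
rewrite /rank -[leqRHS]dimv_sum_cap leq_add // dimvS //.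
  apply: span_imageP => t /setUP[] tAB.
    by apply: (subvP (addvSl _ _)); apply: vec_span.
  by apply: (subvP (addvSr _ _)); apply: vec_span.
apply: span_imageP => t /setIP[tA tB].
by rewrite memv_cap !vec_span.
Qed.

End LinearRank.

(** * Blocks and crossing hedges *)

Lemma partition_representatives (V : finType) (P : {set {set V}}) :
  partition P [set: V] ->
  exists r : V -> V, [/\ forall v, r v \in pblock P v,
    forall u v, pblock P u = pblock P v -> r u = r v &
    #|[set r v | v : V]| = #|P|].
Proof.
move=> partP; have covP v : v \in cover P by rewrite (cover_partition partP).
(* The default is never reached, since [v] lies in its own block; [pick] depends on the block only,
   so [r] is constant on blocks. *)
pose r v := odflt v [pick u in pblock P v].
have r_in v : r v \in pblock P v.
  by rewrite /r; case: pickP => //= /(_ v); rewrite mem_pblock covP.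
have tiP := partition_trivIset partP.
have r_block u v : pblock P u = pblock P v -> r u = r v.
  move=> uv; rewrite /r uv; case: pickP => //= /(_ v).
  by rewrite mem_pblock covP.
have block_r v : pblock P (r v) = pblock P v by apply/same_pblock/r_in.
exists r; split=> //.
have inj : {in [set r v | v : V] &, injective (pblock P)}.
  move=> _ _ /imsetP[u _ ->] /imsetP[v _ ->]; rewrite !block_r.
  exact: r_block.
rewrite -(card_in_imset inj); congr #|pred_of_set _|; apply/setP => B.
apply/imsetP/idP => [[u _ ->]|PB]; first exact: pblock_mem.
have /set0Pn[u uB] : B != set0 by apply: partition_neq0 partP PB.
exists (r u); first by apply: imset_f.
by rewrite block_r (def_pblock tiP PB uB).
Qed.

Lemma mem_deltaP (V : finType) (G : hedgegraph V) (P : {set {set V}}) e :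
  partition P [set: V] ->
  reflect (e \in hedges G /\ exists h u v,
             [/\ h \in e, u \in h, v \in h & pblock P u != pblock P v])
          (e \in delta G P).
Proof.
move=> partP; have tiP := partition_trivIset partP.
have covP v : v \in cover P by rewrite (cover_partition partP).
rewrite inE; apply: (iffP andP) => -[eG].
  case/exists_inP=> h he /card_gt1P[B [C []]].
  rewrite !inE => /andP[PB /pred0Pn[u /andP[/= uh uB]]].
  move=> /andP[PC /pred0Pn[v /andP[/= vh vC]]] BC.
  split=> //; exists h, u, v; split=> //.
  by rewrite (def_pblock tiP PB uB) (def_pblock tiP PC vC).
case=> h [u [v [he uh vh uv]]]; split=> //; apply/exists_inP; exists h => //.
apply/card_gt1P; exists (pblock P u), (pblock P v).
by split=> //; rewrite inE pblock_mem //=; apply/pred0Pn;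
  [exists u | exists v]; rewrite /= mem_pblock covP andbT.
Qed.

(** * Rank of coloured edges *)

Section ColouredEdges.
Variables (V : finType) (k : nat).
Implicit Types t : V * V * 'I_k.

Definition edge_vec t := (axis (t.1.1, t.2) - axis (t.1.2, t.2))%R.

(** Ordered pairs and loops are harmless: reversal changes the sign of the vector, and a loop has
    vector 0. *)
Definition hedge_edges (e : {set {set V}}) : {set V * V * 'I_k} :=
  [set t | [exists h in e, (t.1.1 \in h) && (t.1.2 \in h)]].

(* The classes of [u ~ v] iff every coloured copy of the edge [uv] lies in the
   span of the edges of [A] form a partition that no hedge of [A] crosses. *)
Lemma partition_connected_rank (G : hedgegraph V) :
  (forall P : {set {set V}}, partition P [set: V] ->
     k * (#|P| - 1) <= #|delta G P|) ->
  forall A : {set {set {set V}}},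
    k * (#|V| - 1) <=
      rank edge_vec (\bigcup_(e in A) hedge_edges e) + #|hedges G :\: A|.
Proof.
move=> conn A; rewrite /rank; set W := <<_>>%VS.
pose R u v := [forall i : 'I_k, edge_vec (u, v, i) \in W].
have R_equiv : {in [set: V] & &, equivalence_rel R}.
  move=> u v w _ _ _; split.
    by apply/forallP => i; rewrite /edge_vec subrr mem0v.
  move=> /forallP uv; apply/forallP/forallP => [uw|vw] i.
    have := memvB (uw i) (uv i); rewrite /edge_vec /= opprB.
    by rewrite addrC addrA subrK.
  have := memvD (uv i) (vw i); rewrite /edge_vec /=.
  by rewrite addrA subrK.
pose P := equivalence_partition R [set: V].
have partP : partition P [set: V] := equivalence_partitionP R_equiv.
have pblockR u v : (v \in pblock P u) = R u v.
  exact: (pblock_equivalence_partition R_equiv (in_setT u) (in_setT v)).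
have le_delta : #|delta G P| <= #|hedges G :\: A|.
  apply/subset_leq_card/subsetP => e /(mem_deltaP _ _ partP).
  case=> eG [h [u [v [he uh vh]]]]; rewrite inE eG andbT; apply: contra => eA.
  have uv : v \in pblock P u; last by rewrite (same_pblock (partition_trivIset partP) uv).
  rewrite pblockR; apply/forallP => i; apply: vec_span.
  apply/bigcupP; exists e => //; rewrite inE.
  by apply/exists_inP; exists h => //=; rewrite uh vh.
have [r [r_in _ cardr]] := partition_representatives partP.
(* Modulo [W] each axis equals that of its representative, so [W + Z] is the whole space and
   [\dim W] is at least [k * (#|V| - #|P|)]; the crossing hedges supply the remaining
   [k * (#|P| - 1)]. *)
pose Z := <<[seq axis p | p in setX [set r v | v : V] [set: 'I_k]]>>%VS.
have le_Z : \dim Z <= k * #|P|.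
  rewrite (leq_trans (dim_span _)) // size_image cardsX cardr cardsT card_ord.
  by rewrite mulnC.
have le_V : #|V| * k <= \dim (W + Z).
  rewrite -[k in leqLHS]card_ord -card_prod; apply: card_leq_dim => -[v i].
  rewrite -[axis _](subrK (axis (r v, i))) memv_add //.
    by have := r_in v; rewrite pblockR => /forallP/(_ i).
  by apply: vec_span; apply/setXP; rewrite imset_f ?inE.
have arith n p d w z s c : n * k <= s -> s + c = w + z -> z <= k * p ->
    k * (p - 1) <= d -> k * (n - 1) <= w + d by rewrite !mulnBr; lia.
apply: arith le_V (dimv_sum_cap W Z) le_Z _.
exact: leq_trans (conn P partP) le_delta.
Qed.

(* The edges of [S] not counted here lie in the span of the differences with a
   fixed vertex in the colours other than [i], and of the differences with the
   representative of the block in colour [i]. *)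
Lemma rank_crossing_edges (P : {set {set V}}) (i : 'I_k)
    (S : {set V * V * 'I_k}) :
  0 < #|V| -> partition P [set: V] ->
  k * (#|V| - 1) <= rank edge_vec S ->
  #|P| - 1 <=
    #|[set t in S | (t.2 == i) && (pblock P t.1.1 != pblock P t.1.2)]|.
Proof.
move=> V_gt0 partP; rewrite /rank.
set D := [set t in S | _]; have /card_gt0P[v0 _] := V_gt0.
have [r [r_in r_block cardr]] := partition_representatives partP.
have rr v : r (r v) = r v.
  exact/r_block/(same_pblock (partition_trivIset partP))/r_in.
pose W1 := <<[seq (axis p - axis (v0, p.2))%R
               | p in setX [set~ v0] [set~ i]]>>%VS.
pose W2 := <<[seq (axis (v, i) - axis (r v, i))%R
               | v in ~: [set r v | v : V]]>>%VS.
have memW1 v j : j != i -> (axis (v, j) - axis (v0, j))%R \in W1.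
  move=> ji; have [->|v0v] := eqVneq v v0; first by rewrite subrr mem0v.
  apply: (@vec_span _ _ _ (fun p => (axis p - axis (v0, p.2))%R) _ (v, j)).
  by rewrite !inE v0v.
have memW2 v : (axis (v, i) - axis (r v, i))%R \in W2.
  have [/imsetP[u _ ->]|rv] := boolP (v \in [set r v | v : V]).
    by rewrite rr subrr mem0v.
  by apply: (@vec_span _ _ _ (fun v => (axis (v, i) - axis (r v, i))%R) _ v);
    rewrite inE.
have memB (W : {vspace 'rV[rat]_#|{: V * 'I_k}|}) x y z :
    (x - z)%R \in W -> (y - z)%R \in W -> (x - y)%R \in W.
  by move=> xz yz; have := memvB xz yz; rewrite opprB addrA subrK.
have leW : (<<[seq edge_vec t | t in S]>> <=
            W1 + W2 + <<[seq edge_vec t | t in D]>>)%VS.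
  apply: span_imageP => -[[u v] j] tS; rewrite /edge_vec /=.
  have [ji|ji] := eqVneq j i; last first.
    apply: (subvP (addvSl _ _)); apply: (subvP (addvSl _ _)).
    exact: memB (memW1 u j ji) (memW1 v j ji).
  have [uv|uv] := eqVneq (pblock P u) (pblock P v).
    apply: (subvP (addvSl _ _)); apply: (subvP (addvSr _ _)); rewrite ji.
    by have := memW2 v; rewrite -(r_block _ _ uv); apply: memB.
  apply: (subvP (addvSr _ _)).
  by apply: (@vec_span _ _ _ edge_vec _ (u, v, j)); rewrite inE tS /= ji eqxx.
(* Of the rank [k * (#|V| - 1)], [W1] absorbs at most [(k - 1) * (#|V| - 1)] and [W2] at most
   [#|V| - #|P|], which leaves [#|P| - 1] for [D]. *)
have leW1 : \dim W1 <= (#|V| - 1) * (k - 1).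
  by rewrite (leq_trans (dim_span _)) // size_image cardsX !cardsC1 card_ord !subn1.
have leW2 : #|P| + \dim W2 <= #|V|.
  rewrite -(cardsC [set r v | v : V]) cardr leq_add2l.
  by rewrite (leq_trans (dim_span _)) ?size_image.
have leD : \dim <<[seq edge_vec t | t in D]>> <= #|D| := rank_leq_card _ _.
have k_gt0 : 0 < k by apply: leq_ltn_trans (ltn_ord i).
have arith n p w1 w2 w d : 0 < n -> w1 <= (n - 1) * (k - 1) ->
    p + w2 <= n -> w <= w1 + w2 + d -> k * (n - 1) <= w -> p - 1 <= d.
  by move: k_gt0; case: k n => // k' [] // n' _ _; rewrite !subSS !subn0; nia.
apply: arith V_gt0 leW1 leW2 _.
rewrite (leq_trans (dimvS leW)) // (leq_trans (dimv_add_leqif _ _)) //.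
by rewrite leq_add ?dimv_add_leqif.
Qed.

End ColouredEdges.

(** * Decomposition into connected parts *)

Lemma partition_connected_decomposition (V : finType) (G : hedgegraph V)
    (k : nat) : 0 < #|V| ->
  (forall P : {set {set V}}, partition P [set: V] ->
     k * (#|P| - 1) <= #|delta G P|) ->
  exists F : 'I_k -> {set {set {set V}}},
    [/\ forall i, F i \subset hedges G,
        forall i j, i != j -> [disjoint F i & F j] &
        forall i (P : {set {set V}}), partition P [set: V] ->
          #|P| - 1 <= #|delta G P :&: F i|].
Proof.
move=> V_gt0 /partition_connected_rank.
case/(rado_deficiency (@rank_mono _ _ _ _) (@rank_submod _ _ _ _)) => x [x1 le_x].
exists (fun i => [set e in hedges G | [exists t in x e, t.2 == i]]).
split=> [i|i j ij|i P partP].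
- by apply/subsetP => e; rewrite inE => /andP[].
(* A common hedge would have selected edges of two colours, but [x e] has at most one element. *)
- apply/pred0P => e /=; rewrite !inE; apply/negP.
  case/andP=> /andP[_ /exists_inP[t tx ti]] /andP[_ /exists_inP[s sx sj]].
  have [_ /card_le1P/(_ t tx)/(_ s)] := x1 e.
  rewrite sx inE => /esym/eqP st.
  by rewrite -(eqP ti) -(eqP sj) st eqxx in ij.
rewrite (leq_trans (rank_crossing_edges i V_gt0 partP le_x)) //.
(* Every crossing edge of colour [i] is selected by a hedge in [D], and each hedge selects at most
   one edge. *)
set D := _ :&: _; rewrite (@leq_trans #|\bigcup_(e in D) x e|) //.
  apply/subset_leq_card/subsetP => t; rewrite inE.
  case/and3P=> /bigcupP[e eG tx] ti cross; apply/bigcupP; exists e => //.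
  rewrite !inE eG /=; apply/andP; split; last by apply/exists_inP; exists t.
  have : e \in delta G P; last by rewrite inE => /andP[].
  apply/mem_deltaP => //; split=> //.
  have [/subsetP/(_ t tx)] := x1 e.
  rewrite inE => /exists_inP[h he /andP[uh vh]] _.
  by exists h, t.1.1, t.1.2.
rewrite -[leqRHS]muln1 -sum_nat_const.
apply: (@leq_trans (\sum_(e in D) #|x e|)); last first.
  by apply: leq_sum => e _; have [] := x1 e.
elim/big_rec2: _ => [|e m A _ leA]; first by rewrite cards0.
by rewrite (leq_trans (leq_card_setU _ _)) // leq_add2l.
Qed.

Lemma delta_subhedgegraph (V : finType) (G : hedgegraph V)
    (A : {set {set {set V}}}) (sAG : A \subset hedges G) (P : {set {set V}}) :
  delta (subhedgegraph sAG) P = delta G P :&: A.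
Proof.
apply/setP => e; rewrite !inE /= andbAC; congr (_ && _).
by apply/idP/andP => [eA|[]//]; split=> //; apply: (subsetP sAG).
Qed.

Theorem theorem1p2 (V : finType) (G : hedgegraph V) (k : nat) (k_gt0 : 0 < k) :
  partition_connected k G <->
  exists (F : 'I_k -> {set {set {set V}}})
         (sFG : forall i : 'I_k, F i \subset hedges G),
    (forall i j : 'I_k, i != j -> [disjoint F i & F j]) /\
    (forall i : 'I_k, partition_connected 1 (subhedgegraph (sFG i))).
Proof.
split=> [/(partition_connectedP _ k_gt0)[V_gt0 conn]|[F [sFG [disjF connF]]]].
  have [F [sFG disjF connF]] := partition_connected_decomposition V_gt0 conn.
  exists F, sFG; split=> // i; apply/partition_connectedP=> //.
  by split=> // P partP; rewrite mul1n delta_subhedgegraph connF.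
apply/partition_connectedP=> //; split=> [|P partP].
  (* Nonemptiness of [V] comes from the first part, which exists because [k] is positive. *)
  by have /(partition_connectedP _ (ltnSn 0))[] := connF (Ordinal k_gt0).
(* The [k] disjoint parts each contribute at least [#|P| - 1] crossing hedges. *)
apply: (@leq_trans #|\bigcup_(i < k) (delta G P :&: F i)|); last first.
  by apply/subset_leq_card/bigcupsP => i _; apply: subsetIl.
rewrite -[leqRHS]sum1_card partition_disjoint_bigcup => [|i j ij]; last first.
  by rewrite -setI_eq0 setIACA (disjoint_setI0 (disjF i j ij)) setI0.
rewrite -[k in k * _]card_ord -sum_nat_const leq_sum // => i _.
rewrite sum1_card -(delta_subhedgegraph (sFG i)) -[leqLHS]mul1n.
by have /(partition_connectedP _ (ltnSn 0))[_] := connF i; apply.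
Qed.
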